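(* Let $n,m\ge1$, let $f:\mathbb{Z}/n\mathbb{Z}\to\mathbb{Z}/m\mathbb{Z}$, and let $a_0,\dots,a_{n-1}\in\mathbb{Z}/m\mathbb{Z}$ be the unique elements such that $f(x)=\sum_{k=0}^{n-1}a_k\,\big(\binom{x}{k}\bmod m\big)$ for all $x\in\{0,\dots,n-1\}$. Then $f$ is congruence preserving if and only if, for every $k=0,\dots,n-1$, $\mathrm{lcm}(k)$ (considered as an element of $\mathbb{Z}/m\mathbb{Z}$) divides $a_k$ in $\mathbb{Z}/m\mathbb{Z}$.
   Context: Elements of $\mathbb{Z}/n\mathbb{Z}$ are represented by $\{0,\dots,n-1\}$. A function $f:\mathbb{Z}/n\mathbb{Z}\to\mathbb{Z}/m\mathbb{Z}$ is congruence preserving if for every positive divisor $d$ of $m$ and all $a,b\in\{0,\dots,n-1\}$, $a\equiv b\pmod d$ implies $f(a)\equiv f(b)\pmod d$. For $k\ge1$, $\mathrm{lcm}(k)$ is the least common multiple of $1,2,\dots,k$, and $\mathrm{lcm}(0)=1$. An element $c$ divides $a$ in $\mathbb{Z}/m\mathbb{Z}$ if $a=c\,t$ for some $t\in\mathbb{Z}/m\mathbb{Z}$. The existence and uniqueness of the coefficients $a_k$ is part of the setting (every such function has a unique such expansion). *)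

(* Defs.v *)
From HB Require Import structures.
From mathcomp Require Import all_boot all_order all_algebra.

Set Implicit Arguments.
Unset Strict Implicit.
Unset Printing Implicit Defensive.

Import GRing.Theory.
Local Open Scope ring_scope.

(* Z/nZ for n >= 1 is 'I_n'.+1 with n = n'.+1, so that the zero ring (n = 1) is
   included; 'Z_n would denote Z/2Z there.  Addition is that of the canonical
   zmodType on 'I_n'.+1; multiplication is Zp_mul and the reduction map from nat
   is inZp, since zmodp provides a canonical ring structure only for n >= 2. *)

Definition congruence_preserving (n m : nat) (f : 'I_n -> 'I_m) : Prop :=
  forall d : nat, (0 < d)%N -> (d %| m)%N ->
  forall a b : 'I_n, a = b %[mod d] -> f a = f b %[mod d].

Definition lcm_upto (k : nat) : nat := \big[lcmn/1%N]_(1 <= i < k.+1) i.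

Definition Zp_divides (m : nat) (c a : 'I_m.+1) : Prop :=
  exists t : 'I_m.+1, a = Zp_mul c t.

Definition newton_expansion (n m : nat) (f : 'I_n.+1 -> 'I_m.+1)
    (a : 'I_n.+1 -> 'I_m.+1) : Prop :=
  forall x : 'I_n.+1, f x = \sum_(k < n.+1) Zp_mul (a k) (inZp 'C(x, k)).

Lemma newton_expansion_exists_unique (n m : nat) (f : 'I_n.+1 -> 'I_m.+1) :
  exists! a : {ffun 'I_n.+1 -> 'I_m.+1}, newton_expansion f a.
Proof.
pose L (a : {ffun 'I_n.+1 -> 'I_m.+1}) : {ffun 'I_n.+1 -> 'I_m.+1} :=
  [ffun x : 'I_n.+1 => \sum_(k < n.+1) Zp_mul (a k) (inZp 'C(x, k))].
have mul0 (z : 'I_m.+1) : Zp_mul z (inZp 0) = 0.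
  by apply: val_inj; rewrite /= mod0n muln0 mod0n.
have Linj : injective L.
  move=> a b eqL; apply/ffunP => x.
  have [N] := ubnP (x : nat); elim: N x => // N IH x; rewrite ltnS => lexN.
  have := congr1 (fun g : {ffun _ -> _} => g x) eqL; rewrite !ffunE.
  rewrite (bigD1 x) //= [RHS](bigD1 x) //=.
  rewrite [X in _ = _ + X](eq_bigr (fun k => Zp_mul (a k) (inZp 'C(x, k)))).
    by move/addIr; rewrite binn -[inZp 1]/Zp1 !Zp_mulz1.
  move=> k nekx; have [ltkx|ltxk|eqkx] := ltngtP k x.
  - by rewrite (IH k) // (leq_trans ltkx lexN).
  - by rewrite bin_small // !mul0.
  - by rewrite (val_inj eqkx) eqxx in nekx.
have [a fa] : exists a, L a = finfun f.
  by have [g _ gK] := injF_bij Linj; exists (g (finfun f)); rewrite gK.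
exists a; split=> [x|b fb].
  by have := congr1 (fun g : {ffun _ -> _} => g x) fa; rewrite !ffunE.
by apply: Linj; rewrite fa; apply/ffunP => x; rewrite !ffunE fb.
Qed.

(* Main.v *)
Require Import Defs.
From HB Require Import structures.
From mathcomp Require Import all_boot all_order all_algebra.

(** Since [i * 'C(w, i) = w * 'C(w.-1, i.-1)], Vandermonde's identity shows that
    [w] divides [lcm(k) * ('C(x + w, k) - 'C(x, k))]; this settles sufficiency.
    Conversely, let [d] divide [m] with [d <= k], and assume that the
    coefficients below [k] are divisible as required.  Modulo [d], all terms
    of the expansion of [f(k) - f(k - d)] but [a_k] vanish by the same
    divisibility, so [d] divides [a_k].  Taking [d = gcd(i, m)] for [i <= k]
    gives [gcd(lcm(k), m) | a_k], which is divisibility by [lcm(k)] modulo [m]. *)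

Lemma lcm_upto0 : lcm_upto 0 = 1.
Proof. by rewrite /lcm_upto big_geq. Qed.

Lemma lcm_uptoS k : lcm_upto k.+1 = lcmn (lcm_upto k) k.+1.
Proof. by rewrite /lcm_upto big_nat_recr. Qed.

Lemma lcm_upto_gt0 k : 0 < lcm_upto k.
Proof.
by elim: k => [|k IH]; rewrite ?lcm_upto0 // lcm_uptoS lcmn_gt0 IH.
Qed.

Lemma dvdn_lcm_upto k i : 0 < i <= k -> i %| lcm_upto k.
Proof.
elim: k => [|k IH]; first by case: i.
rewrite lcm_uptoS => /andP[i0]; rewrite leq_eqVlt => /orP[/eqP->|ik].
  exact: dvdn_lcmr.
by apply: dvdn_trans (dvdn_lcml _ _); rewrite IH // i0.
Qed.

(** Divisibility makes [nat] a distributive lattice, so [gcdn] distributes over [lcmn] and the left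
    side is the lcm of the [gcdn i m]. *)
Lemma gcdn_lcm_upto_dvd k m a :
  (forall i, 0 < i <= k -> gcdn i m %| a) -> gcdn (lcm_upto k) m %| a.
Proof.
elim: k => [|k IH] ha; first by rewrite lcm_upto0 gcd1n dvd1n.
rewrite lcm_uptoS gcdnC.
have -> : gcdn m (lcmn (lcm_upto k) k.+1)
          = lcmn (gcdn m (lcm_upto k)) (gcdn m k.+1).
  exact: (@Order.DistrLatticeTheory.meetUr _ natdvd).
rewrite dvdn_lcm gcdnC [gcdn m k.+1]gcdnC (ha k.+1) ?leqnn // andbT.
apply: IH => i /andP[i0 ik].
by apply: ha; rewrite i0 leqW.
Qed.

Lemma dvdn_lcm_upto_bin k i w :
  0 < i <= k -> w %| lcm_upto k * 'C(w, i).
Proof.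
move=> ik; have /dvdnP[q ->] := dvdn_lcm_upto _ _ ik.
case: i ik => // i _; case: w => [|w]; first by rewrite muln0.
by rewrite -mulnA -mul_bin_diag mulnCA dvdn_mulr.
Qed.

Lemma lcm_upto_bin_mod k x y d :
  x = y %[mod d] -> lcm_upto k * 'C(x, k) = lcm_upto k * 'C(y, k) %[mod d].
Proof.
wlog le_yx : x y / y <= x.
  by move=> H; case/orP: (leq_total y x) => l e; [|symmetry]; apply: H.
move/eqP; rewrite eqn_mod_dvd // => dw.
apply/eqP; rewrite -{1}(subnK le_yx); set w := x - y in dw *.
(* The head term is ['C(y, k)]; every other term has a factor ['C(w, i)] with [0 < i <= k]. *)
rewrite -binomial.Vandermonde big_ord_recl /= bin0 subn0 mul1n mulnDr.
rewrite -[X in _ == X %[mod d]]addn0.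
rewrite eqn_modDl mod0n big_distrr /=; apply: dvdn_sum => i _.
by rewrite mulnA dvdn_mulr // (dvdn_trans dw) // dvdn_lcm_upto_bin //= ltn_ord.
Qed.

Lemma dvd_mod_bin_mod k c t m d x y : d %| m -> c = lcm_upto k * t %[mod m] ->
  x = y %[mod d] -> c * 'C(x, k) = c * 'C(y, k) %[mod d].
Proof.
move=> dm ec exy.
have {}ec : c = lcm_upto k * t %[mod d] by rewrite -(modn_dvdm c dm) ec modn_dvdm.
rewrite -modnMml ec modnMml -[RHS]modnMml ec modnMml ![_ * t]mulnC -!mulnA.
by rewrite -modnMmr (lcm_upto_bin_mod k _ _ _ exy) modnMmr.
Qed.

(** Lets divisibility in the residue ring be reduced modulo any divisor of [m.+1]. *)
Lemma Zp_divides_mod m c (a : 'I_m.+1) :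
  Zp_divides (inZp c) a <-> exists t, (a : nat) = c * t %[mod m.+1].
Proof.
split=> [[t ->]|[t et]]; first by exists t; rewrite /= modn_mod modnMml.
exists (inZp t); apply: val_inj => /=.
by rewrite modnMml modnMmr -et modn_small.
Qed.

Lemma gcdn_dvd_mod c m a :
  0 < c -> gcdn c m %| a -> exists t, a = c * t %[mod m].
Proof.
(* Bézout: [km * c = kn * m + gcdn c m]; multiplying by [q] gives the witness. *)
move=> c0 /dvdnP[q ->]; case: (egcdnP m c0) => km kn e _.
exists (km * q); rewrite mulnA [c * km]mulnC e mulnDl.
by rewrite mulnAC modnMDl mulnC.
Qed.

Lemma newton_expansion_mod n m (f a : 'I_n.+1 -> 'I_m.+1) :
  newton_expansion f a -> forall x : 'I_n.+1,
  (f x : nat) = \sum_(k < n.+1) a k * 'C(x, k) %[mod m.+1].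
Proof.
move=> hfa x; rewrite hfa.
elim/big_rec2: _ => // k u v _ e; rewrite /= modn_mod modnMmr modnDml.
by rewrite -modnDmr e modnDmr.
Qed.

Lemma modn_sum_eq (I : finType) (P : pred I) (F G : I -> nat) d :
  (forall i, P i -> F i = G i %[mod d]) ->
  \sum_(i | P i) F i = \sum_(i | P i) G i %[mod d].
Proof.
move=> e; elim/big_rec2: _ => // i u v Pi euv.
by rewrite -modnDm (e i Pi) euv modnDm.
Qed.

Theorem theorem3p2 (n m : nat) (f a : 'I_n.+1 -> 'I_m.+1)
    (hfa : newton_expansion f a) :
  congruence_preserving f <->
  (forall k : 'I_n.+1, Zp_divides (inZp (lcm_upto k)) (a k)).
Proof.
have fE d x : d %| m.+1 -> (f x : nat) = \sum_(k < n.+1) a k * 'C(x, k) %[mod d].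
  by move=> dm; rewrite -(modn_dvdm (f x) dm) (newton_expansion_mod _ _ _ _ hfa) modn_dvdm.
split=> [cp k|lcm_dvd d _ dm x y exy]; last first.
  rewrite !fE //; apply: modn_sum_eq => k _.
  have /Zp_divides_mod[t et] := lcm_dvd k.
  exact: dvd_mod_bin_mod dm et exy.
(* Strong induction on [k]. *)
have [N] := ubnP (k : nat); elim: N k => // N IH k; rewrite ltnS => lekN.
apply/Zp_divides_mod/gcdn_dvd_mod; first exact: lcm_upto_gt0.
apply: gcdn_lcm_upto_dvd => i /andP[i0 lik].
set d := gcdn i m.+1.
have dm : d %| m.+1 by apply: dvdn_gcdr.
have d0 : 0 < d by rewrite gcdn_gt0 i0.
have ldk : d <= k by apply: leq_trans lik; rewrite dvdn_leq ?dvdn_gcdl.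
have ltkd : k - d < n.+1 by apply: leq_ltn_trans (leq_subr _ _) (ltn_ord k).
pose x := Ordinal ltkd.
have exk : (x : nat) = k %[mod d] by rewrite -[in RHS](subnK ldk) modnDr.
have /esym/eqP := cp d d0 dm x k exk; rewrite !fE //.
rewrite (bigD1 k) //= [X in _ == X %[mod d]](bigD1 k) //=.
(* On the side of [k - d] the term of index [k] vanishes, since [0 < d <= k] gives [k - d < k]. *)
rewrite binn muln1 ['C(k - d, k)]bin_small ?muln0 ?add0n; last first.
  by rewrite ltn_subrL d0 (leq_trans d0 ldk).
have -> : \sum_(j < n.+1 | j != k) a j * 'C(k - d, j)
          = \sum_(j < n.+1 | j != k) a j * 'C(k, j) %[mod d].
  (* Below [k] the induction hypothesis applies; above [k] both binomials are zero. *)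
  apply: modn_sum_eq => j nejk; have [ltjk|ltkj|/val_inj ejk] := ltngtP j k.
  - have /Zp_divides_mod[t et] := IH j (leq_trans ltjk lekN).
    exact: dvd_mod_bin_mod dm et exk.
  - by rewrite !bin_small ?muln0 // (leq_ltn_trans (leq_subr _ _)).
  - by rewrite ejk eqxx in nejk.
(* The equal sums cancel, leaving [a k] congruent to 0 modulo [d]. *)
by rewrite -[X in _ == X %[mod d]]add0n eqn_modDr mod0n.
Qed.
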